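(* There is a constant $C$ such that every unit distance graph on a convexly independent set of $n\ge2$ points in the plane has at most $2n\log_2 n + Cn$ edges.
   Context: A finite point set $P\subset\mathbb{R}^2$ is convexly independent if no point of $P$ lies in the convex hull of the other points. The unit distance graph on $P$ has vertex set $P$, with $p,q$ adjacent if and only if $|pq|=1$. *)

(* Defs.v *)
From Stdlib Require Import Reals List.
Import ListNotations.
Open Scope R_scope.

Definition point := (R * R)%type.

Definition dist (p q : point) : R :=
  sqrt ((fst p - fst q) ^ 2 + (snd p - snd q) ^ 2).

Definition in_conv_hull (S : list point) (p : point) : Prop :=
  exists w : list R,
    length w = length S /\
    Forall (fun t => 0 <= t) w /\
    fold_right Rplus 0 w = 1 /\
    fst p = fold_right Rplus 0 (map (fun tq => fst tq * fst (snd tq)) (combine w S)) /\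
    snd p = fold_right Rplus 0 (map (fun tq => fst tq * snd (snd tq)) (combine w S)).

Definition convexly_independent (P : list point) : Prop :=
  forall l1 p l2, P = l1 ++ p :: l2 -> ~ in_conv_hull (l1 ++ l2) p.

Definition is_unit (p q : point) : bool :=
  if Req_EM_T (dist p q) 1 then true else false.

Fixpoint unit_edges (P : list point) : nat :=
  match P with
  | [] => 0
  | p :: ps => (length (filter (is_unit p) ps) + unit_edges ps)%nat
  end.

Definition log2 (x : R) : R := ln x / ln 2.

(* Main.v *)
(** Give every vertex of the polygon the supporting direction pointing to its
    counterclockwise successor, and call a unit segment [pq] ahead at [p] if it makes an
    angle at most pi/2 with the supporting direction at [p].  Consider a zigzag of unit
    segments [p'p], [pq], [qq'] with [p, q', q, p'] in counterclockwise order.  If [qq']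
    is ahead at [q], then the angle [pqq'] is smaller than the angle [qpp'].  If [p'] has
    another unit neighbour between [p] and [q'], the reverse inequality holds.

    In a zigzag of segments that are all ahead at both ends, each of the two angles would
    be smaller than the other.  Hence a unit segment ahead at both ends is the last such
    segment at one of its ends and, by reflection, one ahead at neither end is the first
    such at one of its ends: there are at most [2n] of those.  Orient every other segment
    [x -> y] so that it is ahead exactly at [y].  The oriented segments contain no
    [a -> f], [a -> d], [b -> d], [c -> f] with [a, b, c, f, d] counterclockwise, which is
    Füredi's forbidden matrix pattern.  For each [f], all but [log2 n + 1] of the segments
    [a -> f] are such that some later [c -> f] is at most half as far from [a] as some
    later [m -> f]; for each [a], the distances from [a] to those [c] at least double from
    one such [f] to the next, so there are at most [log2 n + 1] of them. *)
From Stdlib Require Import List.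
From mathcomp Require Import all_boot zify.
From Stdlib Require Import Reals Lra.
Require Import Defs.
Set Implicit Arguments.
Unset Strict Implicit.
Open Scope R_scope.

Definition vec (p q : point) : point := (fst q - fst p, snd q - snd p).
Definition dot (u v : point) : R := fst u * fst v + snd u * snd v.
Definition cross (u v : point) : R := fst u * snd v - snd u * fst v.
Definition sqdist (p q : point) : R := dot (vec p q) (vec p q).
Definition orient (p q r : point) : R := cross (vec p q) (vec p r).

Lemma sqdist_sym p q : sqdist p q = sqdist q p.
Proof. by rewrite /sqdist /dot /vec /=; ring. Qed.

Lemma sqdistpp p : sqdist p p = 0.
Proof. by rewrite /sqdist /dot /vec /=; ring. Qed.

Lemma sqdist_gt0 p q : p <> q -> 0 < sqdist p q.
Proof.
case: p q => [a b] [c d] ne; rewrite /sqdist /dot /vec /=.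
have sqr_x := Rle_0_sqr (c - a); have sqr_y := Rle_0_sqr (d - b).
have [ca|ca] := Req_dec (c - a) 0; last first.
  by have := Rsqr_pos_lt _ ca; rewrite /Rsqr in sqr_y *; lra.
have [db|db] := Req_dec (d - b) 0; last first.
  by have := Rsqr_pos_lt _ db; rewrite /Rsqr in sqr_x *; lra.
by case: ne; congr pair; lra.
Qed.

Lemma orient_cycle p q r : orient p q r = orient q r p.
Proof. by rewrite /orient /cross /vec /=; ring. Qed.

Lemma orient_swap p q r : orient p r q = - orient p q r.
Proof. by rewrite /orient /cross /vec /=; ring. Qed.

Lemma orient_swapl p q r : orient q p r = - orient p q r.
Proof. by rewrite /orient /cross /vec /=; ring. Qed.

Lemma orientppr p q : orient p p q = 0.
Proof. by rewrite /orient /cross /vec /=; ring. Qed.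

Lemma orientpqp p q : orient p q p = 0.
Proof. by rewrite -orient_cycle orientppr. Qed.

Lemma orientpqq p q : orient p q q = 0.
Proof. by rewrite orient_cycle orientppr. Qed.

Lemma orient_split p a b c :
  orient a b c = orient p b c + orient p c a + orient p a b.
Proof. by rewrite /orient /cross /vec /=; ring. Qed.

Lemma dot_vecD p q r :
  dot (vec p q) (vec p r) + dot (vec q p) (vec q r) = sqdist p q.
Proof. by rewrite /sqdist /dot /vec /=; ring. Qed.

Lemma dotC u v : dot u v = dot v u.
Proof. by rewrite /dot; ring. Qed.

Lemma crossC u v : cross u v = - cross v u.
Proof. by rewrite /cross; ring. Qed.

Lemma dot_frame u v w : dot u u = 1 -> dot v w = dot u v * dot u w + cross u v * cross u w.
Proof.
move=> uu; transitivity (dot u u * dot v w); first by rewrite uu; ring.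
by rewrite /dot /cross; ring.
Qed.

Lemma cross_frame u v w :
  dot u u = 1 -> cross v w = dot u v * cross u w - cross u v * dot u w.
Proof.
move=> uu; transitivity (dot u u * cross v w); first by rewrite uu; ring.
by rewrite /dot /cross; ring.
Qed.

Lemma frame_neq0 u v : dot u u = 1 -> v <> (0, 0) -> dot u v <> 0 \/ cross u v <> 0.
Proof.
move=> uu v_neq0; have [uv|] := Req_dec (dot u v) 0; [right => uv' | by left].
apply: v_neq0; rewrite [LHS]surjective_pairing; congr pair.
- transitivity (dot u u * fst v); first by rewrite uu; ring.
  transitivity (dot u v * fst u - cross u v * snd u); last by rewrite uv uv'; ring.
  by rewrite /dot /cross; ring.
- transitivity (dot u u * snd v); first by rewrite uu; ring.
  transitivity (dot u v * snd u + cross u v * fst u); last by rewrite uv uv'; ring.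
  by rewrite /dot /cross; ring.
Qed.

Lemma is_unitP p q : reflect (sqdist p q = 1) (is_unit p q).
Proof.
have dist_sqrt : dist p q = sqrt (sqdist p q).
  by rewrite /dist /sqdist /dot /vec /=; congr sqrt; ring.
have sqdist_ge0 : 0 <= sqdist p q by rewrite /sqdist /dot; nra.
rewrite /is_unit dist_sqrt; case: Req_EM_T => /= e; constructor.
  by rewrite -(sqrt_sqrt _ sqdist_ge0) e; ring.
by move=> e1; apply: e; rewrite e1 sqrt_1.
Qed.

Lemma is_unit_sym p q : is_unit p q = is_unit q p.
Proof. by apply/is_unitP/is_unitP; rewrite sqdist_sym. Qed.

Lemma is_unit_irrefl p : is_unit p p = false.
Proof. by apply/is_unitP; rewrite sqdistpp; lra. Qed.

(** * Angles in zigzags of unit segments *)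

(* In these two lemmas [theta = atan2 s c] and [phi = atan2 s' c'] are the angles of a
   zigzag at [(0, 0)] and at [(1, 0)]. *)
Lemma cos_lt_of_support c s c' s' t1 t2 :
  c * c + s * s = 1 -> 0 < s -> c' * c' + s' * s' = 1 -> 0 < s' ->
  t1 <> 0 \/ t2 <> 0 -> 0 <= t2 ->
  0 <= t1 * s + t2 * (1 - c) -> t1 * s' <= t2 * c' -> t1 * c' + t2 * s' <= 0 ->
  c < c'.
Proof.
move=> unit_cs s_gt0 unit_cs' s'_gt0 t_neq0 t2_ge0 left_cs left_cs' ahead.
have t2_gt0 : 0 < t2.
  have [//|t2_eq0] := t2_ge0; have : t1 = 0 by nra.
  lra.
have t1_lt0 : t1 < 0.
  by apply: Rnot_le_lt => t1_ge0; have c_ge0 : 0 <= c'; nra.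
have c'_gt0 : 0 < c' by nra.
have [|c_gt0] := Rle_or_lt c 0; first by lra.
(* [tan theta <= tan (phi / 2) < tan phi] *)
have c_lt1 : c < 1 by nra.
have tan_half : s' * s <= (1 - c) * c' by apply: (Rmult_le_reg_l t2) => //; nra.
have tan_lt : s' * c < s * c'.
  apply: (Rmult_lt_reg_l s) => //.
  by apply: (Rle_lt_trans _ ((1 - c) * c' * c)); nra.
apply: Rnot_le_lt => c'c; have ss' : s <= s' by nra.
nra.
Qed.

Lemma cos_lt_of_inner c s c' s' :
  c * c + s * s = 1 -> 0 < s -> c' * c' + s' * s' = 1 -> 0 < s' ->
  c * c' + s * s' < c -> c' < c.
Proof.
move=> unit_cs s_gt0 unit_cs' s'_gt0 cos_sub_lt.
have c'_lt1 : c' < 1 by nra.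
apply: Rnot_le_lt => cc'.
have ss'_gt0 : 0 < s * s' by exact: Rmult_lt_0_compat.
have c_gt0 : 0 < c by apply: (Rmult_lt_reg_r (1 - c')); lra.
have s's : s' <= s by nra.
have : s' * s' <= s * s' by apply: Rmult_le_compat_r; lra.
nra.
Qed.

(* [e] is a sign: the zigzags with [e = -1] are the mirror images of those with [e = 1]. *)
Lemma angle_lt_of_support e p q p' q' t :
  e * e = 1 -> sqdist p q = 1 -> sqdist p p' = 1 -> sqdist q q' = 1 ->
  0 < e * orient p q p' -> 0 < e * orient q p q' ->
  t <> (0, 0) -> 0 <= cross t (vec q p) -> 0 <= cross t (vec q p') ->
  0 <= cross t (vec q q') -> 0 <= e * dot t (vec q q') ->
  dot (vec p q) (vec p p') < dot (vec q p) (vec q q').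
Proof.
move=> e2 pq pp' qq' opqp' oqpq' t_neq0 tp tp' tq' ahead.
have qp : sqdist q p = 1 by rewrite sqdist_sym.
have signM x y : e * x * (e * y) = x * y.
  by transitivity (e * e * (x * y)); [ring | rewrite e2; ring].
pose u := vec q p.
have cosE : 1 - dot (vec p q) (vec p p') = dot u (vec q p').
  by have := dot_vecD p q p'; rewrite pq /u; lra.
have sinE : orient p q p' = - cross u (vec q p') by exact: orient_swapl.
apply: (@cos_lt_of_support _ (e * orient p q p') _ (e * orient q p q')
  (e * - dot u t) (cross t u)) => //.
- by rewrite signM -(dot_frame _ _ pq).
- by rewrite signM -(dot_frame _ _ qp).
- case: (frame_neq0 qp t_neq0) => ut; [left | right]; apply: contra_not ut => z.
    by case: (Rmult_integral _ _ z) => [e0|ut0]; [rewrite e0 in e2|]; rewrite -/u; lra.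
  by rewrite -/u crossC; lra.
- rewrite signM cosE sinE (crossC t).
  by have := cross_frame t (vec q p') qp; rewrite -/u; lra.
- rewrite signM (crossC t).
  by have := cross_frame t (vec q q') qp; rewrite /orient -/u; lra.
- have -> : e * - dot u t * dot u (vec q q') + cross t u * (e * orient q p q') =
      - (e * (dot u t * dot u (vec q q') + cross u t * cross u (vec q q'))).
    by rewrite (crossC t) /orient -/u; ring.
  by rewrite -(dot_frame _ _ qp); lra.
Qed.

Lemma dot_gt0_of_isosceles p b p' :
  sqdist p p' = sqdist b p' -> p <> b -> 0 < dot (vec p b) (vec p p').
Proof.
move=> isosceles /sqdist_gt0.
suff : sqdist b p' = sqdist p p' + sqdist p b - 2 * dot (vec p b) (vec p p') by lra.
by rewrite /sqdist /dot /vec /=; ring.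
Qed.

Lemma dot_gt0_between u v w :
  0 < cross u w -> 0 <= cross u v -> 0 < cross v w -> 0 < dot u w -> 0 < dot v w.
Proof.
move=> uw uv vw acute.
apply: (Rmult_lt_reg_r (cross u w)) => //; rewrite Rmult_0_l.
suff -> : dot v w * cross u w = dot u w * cross v w + dot w w * cross u v.
  by have : 0 <= dot w w; [rewrite /dot; nra | nra].
by rewrite /dot /cross; ring.
Qed.

Lemma angle_lt_of_inner_neighbour p b q' q p' :
  sqdist p q = 1 -> sqdist p p' = 1 -> sqdist q q' = 1 -> sqdist b p' = 1 ->
  0 < orient p q p' -> 0 < orient q p q' ->
  0 < orient p b q' -> 0 < orient p q' p' -> 0 < orient p b p' ->
  dot (vec q p) (vec q q') < dot (vec p q) (vec p p').
Proof.
move=> pq pp' qq' bp' opqp' oqpq' opbq' opq'p' opbp'.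
have pb : p <> b by move=> pb; move: opbp'; rewrite pb orientppr; lra.
have acute : 0 < dot (vec p q') (vec p p').
  apply: (@dot_gt0_between (vec p b)) => //; first exact: Rlt_le.
  by apply: dot_gt0_of_isosceles; rewrite ?pp'.
have qp : sqdist q p = 1 by rewrite sqdist_sym.
have cosE : 1 - dot (vec q p) (vec q q') = dot (vec p q) (vec p q').
  by have := dot_vecD p q q'; rewrite pq; lra.
have sinE : orient q p q' = - cross (vec p q) (vec p q') by exact: orient_swapl.
apply: (@cos_lt_of_inner _ (orient p q p') _ (orient q p q')) => //.
- by rewrite -(dot_frame _ _ pq).
- by rewrite -(dot_frame _ _ qp).
- by move: acute; rewrite (dot_frame _ _ pq) -cosE sinE /orient; lra.
Qed.

(** * Counterclockwise enumeration of a convexly independent set *)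

(* [(t, p)] is a nonnegative combination of the [(1, s)] with [s] in [S]. *)
Fixpoint in_cone (S : list point) (t : R) (p : point) : Prop :=
  if S is s :: S' then
    exists2 x, 0 <= x & in_cone S' (t - x) (fst p - x * fst s, snd p - x * snd s)
  else t = 0 /\ p = (0, 0).

Lemma in_cone_hull S p : in_cone S 1 p -> in_conv_hull S p.
Proof.
rewrite /in_conv_hull; move: (1) => t.
elim: S t p => [|s S IH] t p /=; first by case=> -> ->; exists [::].
case=> x x_ge0 /IH [w [sz_w [w_ge0 [sum_w [/= fst_p snd_p]]]]].
exists (x :: w); split; [by rewrite /= sz_w | split; [by constructor |]].
by rewrite /= sum_w -fst_p -snd_p; split; [|split]; ring.
Qed.

Lemma in_cone_lincomb S a t p u q : 0 <= a -> in_cone S t p -> in_cone S u q ->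
  in_cone S (a * t + u) (a * fst p + fst q, a * snd p + snd q).
Proof.
move=> a_ge0; elim: S t p u q => [|s S IH] t p u q /=.
  by case=> -> -> [-> ->] /=; split; [|congr pair]; ring.
case=> x x_ge0 px [y y_ge0 qy]; exists (a * x + y); first by nra.
by move: (IH _ _ _ _ px qy); congr in_cone; [|congr pair => /=]; ring.
Qed.

Lemma in_cone0 S : in_cone S 0 (0, 0).
Proof.
elim: S => [|s S IH] //=; exists 0; first exact: Rle_refl.
by move: IH; congr in_cone; [|congr pair]; ring.
Qed.

Lemma in_cone_nth S i : (i < size S)%nat -> in_cone S 1 (nth (0, 0) S i).
Proof.
elim: S i => [|s S IH] [|i] //= lt_i.
  by exists 1; [lra | move: (in_cone0 S); congr in_cone; [|congr pair]; ring].
exists 0; first exact: Rle_refl.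
move: (IH i lt_i); congr in_cone; first by ring.
by rewrite [LHS]surjective_pairing; congr pair; ring.
Qed.

(* The barycentric coordinates are homogeneous: their sum need not be [1]. *)
Definition in_triangle (a b c p : point) : Prop :=
  exists x y z, [/\ [/\ 0 <= x, 0 <= y & 0 <= z], 0 < x + y + z,
    (x + y + z) * fst p = x * fst a + y * fst b + z * fst c &
    (x + y + z) * snd p = x * snd a + y * snd b + z * snd c].

Lemma in_triangle_vertex a b c : in_triangle a b c a.
Proof. by exists 1, 0, 0; split; [split|..]; lra. Qed.

Lemma in_triangle_orient a b c p :
  0 <= orient p b c -> 0 <= orient p c a -> 0 <= orient p a b -> 0 < orient a b c ->
  in_triangle a b c p.
Proof.
move=> pbc pca pab; rewrite (orient_split p) => abc.
by exists (orient p b c), (orient p c a), (orient p a b); split => //;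
   rewrite /orient /cross /vec /=; ring.
Qed.

Lemma in_segment_of_acute a b c : orient a b c = 0 -> b <> c ->
  0 <= dot (vec b a) (vec b c) -> 0 <= dot (vec c a) (vec c b) -> in_triangle b c c a.
Proof.
move=> collinear /sqdist_gt0 bc acute_b acute_c.
(* The coordinates of the projection of [a] to the line [bc]. *)
exists (dot (vec c a) (vec c b)), (dot (vec b a) (vec b c)), 0.
have sumE : dot (vec c a) (vec c b) + dot (vec b a) (vec b c) + 0 = sqdist b c.
  by rewrite /sqdist /dot /vec /=; ring.
rewrite sumE; split=> //; first by split; [..|lra].
- transitivity (dot (vec c a) (vec c b) * fst b + dot (vec b a) (vec b c) * fst c
    + 0 * fst c + orient a b c * (snd b - snd c)); last by rewrite collinear; ring.
  by rewrite /sqdist /orient /dot /cross /vec /=; ring.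
- transitivity (dot (vec c a) (vec c b) * snd b + dot (vec b a) (vec b c) * snd c
    + 0 * snd c + orient a b c * (fst c - fst b)); last by rewrite collinear; ring.
  by rewrite /sqdist /orient /dot /cross /vec /=; ring.
Qed.

Lemma collinear_in_segment a b c : orient a b c = 0 -> a <> b -> b <> c -> c <> a ->
  [\/ in_triangle b c c a, in_triangle c a a b | in_triangle a b b c].
Proof.
move=> abc ab bc ca.
have acute_of_obtuse x y z : x <> y ->
    dot (vec x y) (vec x z) < 0 -> 0 <= dot (vec y x) (vec y z).
  by move=> /sqdist_gt0; have := dot_vecD x y z; lra.
have bca : orient b c a = 0 by rewrite -orient_cycle.
have cab : orient c a b = 0 by rewrite orient_cycle.
have [obt_b|acute_b] := Rlt_or_le (dot (vec b a) (vec b c)) 0.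
  apply: Or32; apply: in_segment_of_acute => //.
    by apply: acute_of_obtuse => //; rewrite dotC.
  by apply: acute_of_obtuse => //; auto.
have [obt_c|acute_c] := Rlt_or_le (dot (vec c a) (vec c b)) 0.
  apply: Or33; apply: in_segment_of_acute => //.
    exact: acute_of_obtuse.
  by apply: acute_of_obtuse; [auto | rewrite dotC].
by apply: Or31; apply: in_segment_of_acute.
Qed.

Lemma in_triangle_conv_hull S a b c p :
  in_cone S 1 a -> in_cone S 1 b -> in_cone S 1 c -> in_triangle a b c p ->
  in_conv_hull S p.
Proof.
move=> Sa Sb Sc [x [y [z [[x_ge0 y_ge0 z_ge0] sum_gt0 fst_p snd_p]]]].
apply: in_cone_hull.
have r_ge0 : 0 <= / (x + y + z) by apply/Rlt_le/Rinv_0_lt_compat.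
have := in_cone_lincomb r_ge0 (in_cone_lincomb x_ge0 Sa (in_cone_lincomb y_ge0 Sb
  (in_cone_lincomb z_ge0 Sc (in_cone0 S)))) (in_cone0 S).
congr in_cone => /=; first by field; lra.
have divE r s : (x + y + z) * r = s -> / (x + y + z) * s = r.
  by move=> <-; field; lra.
rewrite [RHS]surjective_pairing -(divE _ _ fst_p) -(divE _ _ snd_p).
by congr pair; ring.
Qed.

Definition convex_position (T : eqType) (pt : T -> point) : Prop :=
  forall a b c i, i != a -> i != b -> i != c -> ~ in_triangle (pt a) (pt b) (pt c) (pt i).

Definition vertex (P : list point) : 'I_(size P) -> point := fun i => nth (0, 0) P i.

Lemma convexly_independent_convex_position P :
  convexly_independent P -> convex_position (@vertex P).
Proof.
move=> indepP a b c i ia ib ic.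
have others j : i != j :> 'I_(size P) ->
    in_cone (take i P ++ drop i.+1 P) 1 (nth (0, 0) P j).
  rewrite -val_eqE /= => ij; have lti := ltn_ord i; have ltj := ltn_ord j.
  have -> : nth (0, 0) P j = nth (0, 0) (take i P ++ drop i.+1 P) (unbump i j).
    rewrite nth_cat size_take lti /unbump; case: (ltngtP i j) ij => // ltij _.
      rewrite subn1 ifF; last by lia.
      by rewrite nth_drop; congr nth; lia.
    by rewrite subn0 ltij nth_take.
  apply: in_cone_nth; rewrite size_cat size_take size_drop lti /unbump.
  by case: (ltngtP i j) ij => // *; lia.
move/(in_triangle_conv_hull (others a ia) (others b ib) (others c ic)).
apply: indepP; rewrite -drop_nth //.
exact/esym/cat_take_drop.
Qed.

Section ConvexPosition.
Variables (T : eqType) (pt : T -> point).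
Hypothesis pt_convex : convex_position pt.
Local Notation ori i j k := (orient (pt i) (pt j) (pt k)).

Lemma convex_position_inj : injective pt.
Proof.
move=> i j ptij; apply/eqP; apply: contraT => ij.
by case: (pt_convex ij ij ij); rewrite ptij; apply: in_triangle_vertex.
Qed.

Lemma convex_position_noncollinear i j k :
  i != j -> j != k -> k != i -> ori i j k <> 0.
Proof.
move=> ij jk ki; have neq x y : x != y -> pt x <> pt y.
  by move=> xy /convex_position_inj; apply/eqP.
move=> ijk.
case: (collinear_in_segment ijk (neq _ _ ij) (neq _ _ jk) (neq _ _ ki));
  by apply: pt_convex; rewrite // eq_sym.
Qed.

Lemma orient_neq0_distinct i j k : ori i j k <> 0 -> [/\ i != j, j != k & k != i].
Proof.
move=> nz; split; apply: contra_notN nz => /eqP ->.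
- exact: orientppr.
- exact: orientpqq.
- exact: orientpqp.
Qed.

Lemma convex_position_orient_trans o i j k :
  0 < ori o i j -> 0 < ori o j k -> 0 < ori o i k.
Proof.
move=> oij ojk.
have [oi _ jo] : [/\ o != i, i != j & j != o] by apply: orient_neq0_distinct; lra.
have [_ _ ko] : [/\ o != j, j != k & k != o] by apply: orient_neq0_distinct; lra.
have ik : i != k.
  by apply: contraPneq ojk => <-; rewrite orient_swap; lra.
have [oik|[|//]] := Rtotal_order (ori o i k) 0; last first.
  by move=> oik; case: (convex_position_noncollinear oi ik ko).
have oki : 0 < ori o k i by rewrite orient_swap; lra.
case: (@pt_convex i j k o) => //; rewrite 1?eq_sym //.
apply: in_triangle_orient; try exact: Rlt_le.
by rewrite (orient_split (pt o)); lra.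
Qed.

Lemma convex_position_orient_triangle o i j k :
  0 < ori o i j -> 0 < ori o j k -> 0 < ori o i k -> 0 < ori i j k.
Proof.
move=> oij ojk oik; apply: Rnot_le_lt => ijk.
have [_ ij jo] : [/\ o != i, i != j & j != o] by apply: orient_neq0_distinct; lra.
have [_ jk _] : [/\ o != j, j != k & k != o] by apply: orient_neq0_distinct; lra.
case: (@pt_convex o i k j) => //; first by rewrite eq_sym.
apply: in_triangle_orient => //.
- by rewrite orient_swapl; lra.
- by rewrite -orient_cycle; lra.
- by rewrite orient_cycle; lra.
Qed.

Section Sweep.
Variable o : T.

(* The order in which a ray rotating around [pt o] meets the other points. *)
Definition sweep : rel T := fun i j => (i == o) || (j != o) && Rle_dec 0 (ori o i j).

Lemma sweepP i j : i != o -> j != o -> reflect (i = j \/ 0 < ori o i j) (sweep i j).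
Proof.
move=> io jo; rewrite /sweep (negPf io) jo /=.
apply: (iffP (sumboolP _)) => [oij | [->|]]; last exact: Rlt_le.
  have [|ij] := eqVneq i j; [by left | right].
  have oi : o != i by rewrite eq_sym.
  by have := convex_position_noncollinear oi ij jo; lra.
by rewrite orientpqq; exact: Rle_refl.
Qed.

Lemma sweep_total : total sweep.
Proof.
move=> i j; have [->|io] := eqVneq i o; first by rewrite /sweep eqxx.
have [->|jo] := eqVneq j o; first by rewrite /sweep eqxx orbT.
rewrite /sweep (negPf io) (negPf jo) /=; apply/orP.
have [oij|oij] := Rle_or_lt 0 (ori o i j); [left | right]; apply/sumboolP => //.
by rewrite orient_swap; lra.
Qed.

Lemma sweep_trans : transitive sweep.
Proof.
move=> j i k; have [->|io] := eqVneq i o; first by rewrite {3}/sweep eqxx.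
have [->|jo] := eqVneq j o; first by rewrite {1}/sweep (negPf io) eqxx.
have [->|ko] := eqVneq k o; first by rewrite {2}/sweep (negPf jo) eqxx.
move=> /sweepP-/(_ io jo)[->//|oij] /sweepP-/(_ jo ko)[<-|ojk].
  by apply/sweepP => //; right.
by apply/sweepP => //; right; apply: (convex_position_orient_trans oij).
Qed.

Lemma sweep_orient i j k :
  i != j -> j != k -> k != i -> sweep i j -> sweep j k -> 0 < ori i j k.
Proof.
move=> ij jk ki sij sjk; have sik := sweep_trans sij sjk.
have pos x y : x != o -> y != o -> x != y -> sweep x y -> 0 < ori o x y.
  by move=> xo yo xy /sweepP-/(_ xo yo)[e|//]; rewrite e eqxx in xy.
have [io|io] := eqVneq i o.
  have jo : j != o by rewrite -io eq_sym.
  have ko : k != o by rewrite -io.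
  by rewrite io; apply: pos.
have jo : j != o by apply: contraTneq sij => ->; rewrite /sweep (negPf io) eqxx.
have ko : k != o by apply: contraTneq sik => ->; rewrite /sweep (negPf io) eqxx.
by apply: (@convex_position_orient_triangle o); apply: pos => //; rewrite eq_sym.
Qed.
End Sweep.
End ConvexPosition.

Definition counterclockwise (n : nat) (pt : 'I_n -> point) : Prop :=
  forall i j k : 'I_n, (i < j)%nat -> (j < k)%nat -> 0 < orient (pt i) (pt j) (pt k).

Lemma counterclockwise_enumeration n (pt : 'I_n -> point) : convex_position pt ->
  exists2 s : 'I_n -> 'I_n, injective s & counterclockwise (pt \o s).
Proof.
case: n pt => [|n] pt pt_convex; first by exists (fun i => i) => // -[].
pose l := sort (sweep pt ord0) (enum 'I_n.+1).
have size_l : size l = n.+1 by rewrite size_sort size_enum_ord.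
have uniq_l : uniq l by rewrite sort_uniq enum_uniq.
have nth_neq i j : (i < j <= n)%nat -> nth ord0 l i != nth ord0 l j.
  by move=> ij; rewrite nth_uniq ?size_l; lia.
have nth_sweep i j : (i < j <= n)%nat -> sweep pt ord0 (nth ord0 l i) (nth ord0 l j).
  move=> ij; have sorted_l := sort_sorted (sweep_total pt ord0) (enum 'I_n.+1).
  by apply: (sorted_ltn_nth (sweep_trans pt_convex (o := ord0))) => //;
     rewrite ?inE ?size_l; lia.
exists (fun i => nth ord0 l i) => [i j /eqP|i j k ij jk /=].
  by rewrite nth_uniq ?size_l ?ltn_ord // => /eqP /val_inj.
have lt_k := ltn_ord k; apply: (sweep_orient pt_convex (o := ord0)).
- by apply: nth_neq; lia.
- by apply: nth_neq; lia.
- by rewrite eq_sym; apply: nth_neq; lia.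
- by apply: nth_sweep; lia.
- by apply: nth_sweep; lia.
Qed.

(** * Counting pairs of a relation *)

Section Counting.
Local Open Scope nat_scope.

Definition num_pairs (T : finType) (E : rel T) : nat := \sum_x \sum_y E x y.

Section NumPairs.
Variable T : finType.
Implicit Types E F : rel T.

Lemma num_pairs_le_degree E k : (forall x, #|E x| <= k) -> num_pairs E <= #|T| * k.
Proof.
move=> degE; rewrite /num_pairs -sum_nat_const; apply: leq_sum => x _.
by apply: leq_trans (degE x); rewrite -sum1_card [leqRHS]big_mkcond leq_sum.
Qed.

Lemma num_pairs_converse E : num_pairs (fun x y => E y x) = num_pairs E.
Proof. exact: exchange_big. Qed.

Lemma num_pairs_cover E E1 E2 :
  (forall x y, E x y -> E1 x y || E2 x y) -> num_pairs E <= num_pairs E1 + num_pairs E2.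
Proof.
move=> covE; rewrite -big_split; apply: leq_sum => x _.
rewrite -big_split; apply: leq_sum => y _ /=.
by have := covE x y; case: (E x y) => // /(_ isT); case: (E1 x y); case: (E2 x y).
Qed.

Lemma num_pairs_cover_converse E F :
  (forall x y, E x y -> F x y || F y x) -> num_pairs E <= 2 * num_pairs F.
Proof.
by rewrite mul2n -addnn -{2}(num_pairs_converse F); apply: num_pairs_cover.
Qed.

Lemma num_pairs_reindex E (s : T -> T) :
  injective s -> num_pairs (fun x y => E (s x) (s y)) = num_pairs E.
Proof.
move=> s_inj; rewrite /num_pairs [RHS](reindex_inj s_inj).
by apply: eq_bigr => x _; rewrite [RHS](reindex_inj s_inj).
Qed.

Section Farthest.
Variables (E : rel T) (d : T -> T -> nat).

Definition farthest : rel T :=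
  fun x y => E x y && [forall z, E x z ==> (d x z <= d x y)].

Definition zigzag_free : Prop := forall x y x' y', E x y -> E x x' -> E y y' ->
  d x y < d x x' -> d y x < d y y' -> False.

Lemma farthestPn x y : E x y -> ~~ farthest x y -> exists2 z, E x z & d x y < d x z.
Proof.
rewrite /farthest => -> /=; rewrite negb_forall => /existsP[z].
by rewrite negb_imply -ltnNge => /andP[]; exists z.
Qed.

Lemma card_farthest x : injective (d x) -> #|farthest x| <= 1.
Proof.
move=> d_inj; apply/card_le1_eqP => y z; rewrite !unfold_in.
move=> /andP[xy /forallP far_y] /andP[xz /forallP far_z]; apply: d_inj.
by apply/eqP; rewrite eqn_leq (implyP (far_y z)) // (implyP (far_z y)).
Qed.

Lemma num_pairs_zigzag_free :
  (forall x, injective (d x)) -> symmetric E -> zigzag_free -> num_pairs E <= 2 * #|T|.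
Proof.
move=> d_inj E_sym E_free.
have le_far : num_pairs farthest <= #|T|.
  by rewrite -[leqRHS]muln1; apply: num_pairs_le_degree => x; apply: card_farthest.
apply: leq_trans (_ : 2 * num_pairs farthest <= _); last by rewrite leq_mul2l.
apply: num_pairs_cover_converse => x y xy.
apply: contraT; rewrite negb_or => /andP[nfar_xy nfar_yx].
have yx : E y x by rewrite E_sym.
have [x' xx' lt_x] := farthestPn xy nfar_xy; have [y' yy' lt_y] := farthestPn yx nfar_yx.
by case: (E_free x y x' y').
Qed.
End Farthest.
End NumPairs.

Lemma card_le_log_of_doubling (T : finType) (S : {pred T}) (key v : T -> nat) (N : nat) :
    {in S &, injective key} -> (forall x, x \in S -> 0 < v x <= N) ->
    (forall x y, x \in S -> y \in S -> key x < key y -> 2 * v x <= v y) ->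
  #|S| <= (trunc_log 2 N).+1.
Proof.
move=> key_inj v_bound doubling.
pose g x : 'I_(trunc_log 2 N).+1 := inord (trunc_log 2 (v x)).
have g_val x : x \in S -> g x = trunc_log 2 (v x) :> nat.
  by move=> /v_bound /andP[_ vN]; rewrite inordK // ltnS leq_trunc_log.
have g_lt x y : x \in S -> y \in S -> key x < key y -> g x < g y.
  move=> xS yS /(doubling _ _ xS yS) le2; rewrite !g_val //.
  have /andP[vx_gt0 _] := v_bound x xS.
  by apply: leq_trans (leq_trunc_log 2 le2); rewrite trunc_logMp.
have g_inj : {in S &, injective g}.
  move=> x y xS yS gxy; apply: key_inj => //; apply/eqP; rewrite eqn_leq.
  apply/andP; split; rewrite leqNgt; apply/negP.
  - by move=> /(g_lt _ _ yS xS); rewrite gxy ltnn.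
  - by move=> /(g_lt _ _ xS yS); rewrite gxy ltnn.
by rewrite -(card_ord (trunc_log 2 N).+1) -(card_in_image g_inj) max_card.
Qed.

Definition ccw_dist (n i j : nat) : nat := if i <= j then j - i else n + j - i.

Section CcwDist.
Variable n : nat.
Local Notation arc := (ccw_dist n).
Implicit Types i j k : 'I_n.

Lemma ccw_dist_lt i j : arc i j < n.
Proof. by move: (ltn_ord i) (ltn_ord j); rewrite /ccw_dist; case: (leqP i j); lia. Qed.

Lemma ccw_dist_gt0 i j : (0 < arc i j) = (i != j).
Proof.
move: (ltn_ord i) (ltn_ord j).
by rewrite -val_eqE /ccw_dist /=; case: (leqP i j); lia.
Qed.

Lemma ccw_dist_injr i : injective (fun j : 'I_n => arc i j).
Proof.
move=> j k jk; apply: val_inj; move: jk (ltn_ord i) (ltn_ord j) (ltn_ord k) => /=.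
by rewrite /ccw_dist; case: (leqP i j); case: (leqP i k); lia.
Qed.

Lemma ccw_dist_injl j : injective (fun i : 'I_n => arc i j).
Proof.
move=> i k ik; apply: val_inj; move: ik (ltn_ord i) (ltn_ord j) (ltn_ord k) => /=.
by rewrite /ccw_dist; case: (leqP i j); case: (leqP k j); lia.
Qed.

Lemma ccw_dist_ordS i j : i != j -> arc i (ordS i) = 1.
Proof.
rewrite -val_eqE /ccw_dist /=; move: (ltn_ord i) (ltn_ord j) => lt_i lt_j ij.
have [lt_Si|Si_eq] : i.+1 < n \/ i.+1 = n by lia.
  by rewrite modn_small // ifT; lia.
by rewrite Si_eq modnn ifF; lia.
Qed.

Lemma ccw_dist_cat i j k : arc j k <= arc i k -> arc i j + arc j k = arc i k.
Proof.
move: (ltn_ord i) (ltn_ord j) (ltn_ord k); rewrite /ccw_dist.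
by case: (leqP i j); case: (leqP j k); case: (leqP i k); lia.
Qed.

Section FurediFree.
Variable M : rel 'I_n.

Definition furedi_free : Prop := forall a b c f d, M a f -> M a d -> M b d -> M c f ->
  0 < arc a b -> arc a b < arc a c -> arc a c < arc a f -> arc a f < arc a d -> False.

Definition halfway (a f c : 'I_n) : bool := [&& M c f, 0 < arc a c &
  [exists m, [&& M m f, 2 * arc a c <= arc a m & arc a m < arc a f]]].

Definition halved : rel 'I_n := fun a f => M a f && [exists c, halfway a f c].
Definition unhalved : rel 'I_n := fun a f => M a f && ~~ [exists c, halfway a f c].

Lemma card_halved a : furedi_free -> #|halved a| <= (trunc_log 2 n).+1.
Proof.
move=> M_free; pose c f := odflt a [pick c | halfway a f c].
have halfway_c f : f \in halved a -> halfway a f (c f).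
  rewrite unfold_in => /andP[_ /existsP[c0 c0P]]; rewrite /c.
  by case: pickP => [//|/(_ c0)]; rewrite c0P.
apply: (@card_le_log_of_doubling _ (halved a) (fun f => arc a f) (fun f => arc a (c f))).
- by move=> f d _ _; apply: ccw_dist_injr.
- by move=> f /halfway_c /and3P[_ -> _]; apply/ltnW/ccw_dist_lt.
move=> f d f_halved d_halved lt_fd.
have /and3P[_ _ /existsP[m /and3P[mf le_cm lt_mf]]] := halfway_c f f_halved.
have /and3P[cd c_gt0 _] := halfway_c d d_halved.
apply: leq_trans le_cm _; rewrite leqNgt; apply/negP => lt_cm.
have [/andP[af _] /andP[ad _]] := (f_halved, d_halved).
exact: (M_free a (c d) m f d).
Qed.

Lemma card_unhalved f : irreflexive M -> #|unhalved^~ f| <= (trunc_log 2 n).+1.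
Proof.
move=> M_irr; have [a0 a0f|no_a] := pickP (M^~ f); last first.
  by rewrite eq_card0 // => a; rewrite unfold_in /unhalved no_a.
have [m mf m_nearest] := @arg_minnP _ a0 (M^~ f) (fun a => arc a f) a0f.
pose v a := (arc a f - arc m f).+1.
apply: (@card_le_log_of_doubling _ (unhalved^~ f) (fun a => arc a f) v).
- by move=> a b _ _; apply: ccw_dist_injl.
- by move=> a _; rewrite /v; have := ccw_dist_lt a f; lia.
have neq_f a : M a f -> a != f by apply: contraTneq => ->; rewrite M_irr.
move=> b a /andP[bf _] /andP[af not_halved] lt_ba; rewrite /v.
have [le_mb le_ma] := (m_nearest b bf, m_nearest a af).
move: not_halved; rewrite negb_exists => /forallP/(_ b).
rewrite /halfway bf /= negb_and -leqNgt negb_exists.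
have mf_gt0 : 0 < arc m f by rewrite ccw_dist_gt0 neq_f.
have := ccw_dist_cat (ltnW lt_ba); have := ccw_dist_cat le_ma.
move=> am ab /orP[|/forallP/(_ m)]; first by lia.
by rewrite mf /=; lia.
Qed.

Lemma num_pairs_furedi_free :
  irreflexive M -> furedi_free -> num_pairs M <= n * (2 * (trunc_log 2 n).+1).
Proof.
move=> M_irr M_free.
have cover x y : M x y -> halved x y || unhalved x y.
  by rewrite /halved /unhalved => ->; case: [exists c, _].
apply: leq_trans (num_pairs_cover cover) _.
rewrite mul2n -addnn mulnDr -[num_pairs unhalved]num_pairs_converse.
have := @num_pairs_le_degree 'I_n; rewrite card_ord => le_degree.
by apply: leq_add; apply: le_degree => x; [exact: card_halved | exact: card_unhalved].
Qed.
End FurediFree.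
End CcwDist.
End Counting.

(** * Unit distances in a convex polygon *)

Section ConvexPolygon.
Variables (n : nat) (pt : 'I_n -> point).
Hypotheses (pt_inj : injective pt) (pt_ccw : counterclockwise pt).
Local Notation arc := (ccw_dist n).
Implicit Types i j k p q : 'I_n.

Lemma orient_gt0_of_ccw_dist i j k : (0 < arc i j)%nat -> (arc i j < arc i k)%nat ->
  0 < orient (pt i) (pt j) (pt k).
Proof.
move=> ij_gt0 lt_jk.
have [[ij jk]|[[jk ki]|[ki ij]]] :
    (i < j /\ j < k \/ j < k /\ k < i \/ k < i /\ i < j)%nat.
  move: ij_gt0 lt_jk (ltn_ord i) (ltn_ord j) (ltn_ord k); rewrite /ccw_dist.
  by case: (leqP i j); case: (leqP i k); lia.
- exact: pt_ccw.
- by rewrite orient_cycle; apply: pt_ccw.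
- by rewrite -orient_cycle; apply: pt_ccw.
Qed.

Lemma orient_lt0_of_ccw_dist i j k : (0 < arc j i)%nat -> (arc j i < arc k i)%nat ->
  orient (pt i) (pt j) (pt k) < 0.
Proof.
move=> ji_gt0 lt_jk; suff : 0 < orient (pt i) (pt k) (pt j) by rewrite orient_swap; lra.
rewrite orient_cycle; have := ccw_dist_cat (ltnW lt_jk).
by move=> ?; apply: orient_gt0_of_ccw_dist; lia.
Qed.

Definition tangent i : point := vec (pt i) (pt (ordS i)).

Lemma tangent_neq0 i j : i != j -> tangent i <> (0, 0).
Proof.
move=> ij [x0 y0]; have Si_i : ordS i = i.
  apply: pt_inj; rewrite [LHS]surjective_pairing [RHS]surjective_pairing.
  by congr pair; lra.
by move: (ccw_dist_ordS ij) (ccw_dist_gt0 i i); rewrite Si_i eqxx => ->.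
Qed.

Lemma tangent_support i j : 0 <= cross (tangent i) (vec (pt i) (pt j)).
Proof.
rewrite -[cross _ _]/(orient _ _ _).
have [<-|ij] := eqVneq i j; first by rewrite orientpqp; apply: Rle_refl.
have [<-|Sij] := eqVneq (ordS i) j; first by rewrite orientpqq; apply: Rle_refl.
have arc_neq1 : arc i j <> 1%nat.
  by rewrite -(ccw_dist_ordS ij) => /ccw_dist_injr/esym/eqP; apply/negP.
move: (ij) (ccw_dist_ordS ij); rewrite -ccw_dist_gt0 => ? ?.
by apply/Rlt_le/orient_gt0_of_ccw_dist; lia.
Qed.

Definition unit_rel : rel 'I_n := fun i j => is_unit (pt i) (pt j).
Definition ahead : rel 'I_n := fun i j => Rle_dec 0 (dot (tangent i) (vec (pt i) (pt j))).

Lemma aheadP i j :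
  reflect (0 <= dot (tangent i) (vec (pt i) (pt j))) (ahead i j).
Proof. exact: sumboolP. Qed.

Lemma unit_rel_sym : symmetric unit_rel.
Proof. by move=> i j; apply: is_unit_sym. Qed.

Lemma unit_rel_neq i j : unit_rel i j -> i != j.
Proof. by apply: contraTneq => ->; rewrite /unit_rel is_unit_irrefl. Qed.

Lemma unit_rel_ccw_gt0 i j : unit_rel i j -> (0 < arc i j)%nat.
Proof. by move=> /unit_rel_neq; rewrite ccw_dist_gt0. Qed.

Lemma no_zigzag_ahead e p q p' q' : e * e = 1 ->
  unit_rel p q -> unit_rel p p' -> unit_rel q q' ->
  0 < e * orient (pt p) (pt q) (pt p') -> 0 < e * orient (pt q) (pt p) (pt q') ->
  0 <= e * dot (tangent p) (vec (pt p) (pt p')) ->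
  0 <= e * dot (tangent q) (vec (pt q) (pt q')) -> False.
Proof.
move=> e2 pq pp' qq' opqp' oqpq' ahead_p ahead_q.
have qp : unit_rel q p by rewrite unit_rel_sym.
have tangent_p := tangent_neq0 (unit_rel_neq pq).
have tangent_q := tangent_neq0 (unit_rel_neq qp).
move: pq qp pp' qq' => /is_unitP pq /is_unitP qp /is_unitP pp' /is_unitP qq'.
have := angle_lt_of_support e2 pq pp' qq' opqp' oqpq' tangent_q
  (tangent_support q p) (tangent_support q p') (tangent_support q q') ahead_q.
have := angle_lt_of_support e2 qp qq' pp' oqpq' opqp' tangent_p
  (tangent_support p q) (tangent_support p q') (tangent_support p p') ahead_p.
lra.
Qed.

Definition ahead_both : rel 'I_n := fun i j => [&& unit_rel i j, ahead i j & ahead j i].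
Definition ahead_neither : rel 'I_n :=
  fun i j => [&& unit_rel i j, ~~ ahead i j & ~~ ahead j i].
Definition ahead_target : rel 'I_n :=
  fun i j => [&& unit_rel i j, ~~ ahead i j & ahead j i].

Lemma ahead_both_sym : symmetric ahead_both.
Proof. by move=> i j; rewrite /ahead_both unit_rel_sym [ahead i j && _]andbC. Qed.

Lemma ahead_neither_sym : symmetric ahead_neither.
Proof. by move=> i j; rewrite /ahead_neither unit_rel_sym [~~ ahead i j && _]andbC. Qed.

Lemma ahead_target_irr : irreflexive ahead_target.
Proof. by move=> i; rewrite /ahead_target /unit_rel is_unit_irrefl. Qed.

Lemma ahead_both_zigzag_free : zigzag_free ahead_both (fun i j => arc i j).
Proof.
move=> p q p' q' /and3P[pq _ _] /and3P[pp' /aheadP ahead_p _] /and3P[qq' /aheadP ahead_q _].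
have qp : unit_rel q p by rewrite unit_rel_sym.
move=> /(orient_gt0_of_ccw_dist (unit_rel_ccw_gt0 pq)) opqp'.
move=> /(orient_gt0_of_ccw_dist (unit_rel_ccw_gt0 qp)) oqpq'.
by apply: (@no_zigzag_ahead 1 p q p' q') => //; rewrite ?Rmult_1_l.
Qed.

Lemma ahead_neither_zigzag_free : zigzag_free ahead_neither (fun i j => arc j i).
Proof.
move=> p q p' q' /and3P[pq _ _] /and3P[pp' /aheadP behind_p _].
move=> /and3P[qq' /aheadP behind_q _].
have qp : unit_rel q p by rewrite unit_rel_sym.
move=> /(orient_lt0_of_ccw_dist (unit_rel_ccw_gt0 qp)) opqp'.
move=> /(orient_lt0_of_ccw_dist (unit_rel_ccw_gt0 pq)) oqpq'.
by apply: (@no_zigzag_ahead (-1) p q p' q') => //; lra.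
Qed.

Lemma ahead_target_furedi_free : furedi_free ahead_target.
Proof.
move=> a b c f d /and3P[af _ _] /and3P[ad _ _] /and3P[bd _ _] /and3P[cf _ /aheadP ahead_fc].
move=> ab lt_bc lt_cf lt_fd; have ac := ltn_trans ab lt_bc.
have ofca := orient_gt0_of_ccw_dist ac lt_cf; rewrite -orient_cycle in ofca.
have oafd := orient_gt0_of_ccw_dist (unit_rel_ccw_gt0 af) lt_fd.
have fa : unit_rel f a by rewrite unit_rel_sym.
have tangent_f := tangent_neq0 (unit_rel_neq fa).
have fc : unit_rel f c by rewrite unit_rel_sym.
move: af ad bd fc => /is_unitP af /is_unitP ad /is_unitP bd /is_unitP fc.
have : dot (vec (pt a) (pt f)) (vec (pt a) (pt d)) <
       dot (vec (pt f) (pt a)) (vec (pt f) (pt c)).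
  by apply: (angle_lt_of_support (e := 1) (t := tangent f)); rewrite ?Rmult_1_l //;
     exact: tangent_support.
apply/Rle_not_lt/Rlt_le/(angle_lt_of_inner_neighbour (b := pt b)) => //.
- exact: orient_gt0_of_ccw_dist.
- exact: orient_gt0_of_ccw_dist (ltn_trans lt_cf lt_fd).
- exact: orient_gt0_of_ccw_dist (ltn_trans lt_bc (ltn_trans lt_cf lt_fd)).
Qed.

Lemma num_pairs_unit_rel : (num_pairs unit_rel <= n * (4 * trunc_log 2 n + 8))%nat.
Proof.
have both_le :=
  num_pairs_zigzag_free (@ccw_dist_injr n) ahead_both_sym ahead_both_zigzag_free.
have neither_le :=
  num_pairs_zigzag_free (@ccw_dist_injl n) ahead_neither_sym ahead_neither_zigzag_free.
have target_le := num_pairs_furedi_free ahead_target_irr ahead_target_furedi_free.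
rewrite card_ord in both_le neither_le.
pose equal i j := ahead_both i j || ahead_neither i j.
have equal_le : (num_pairs equal <= num_pairs ahead_both + num_pairs ahead_neither)%nat.
  exact: num_pairs_cover.
pose mixed i j := ahead_target i j || ahead_target j i.
have mixed_le : (num_pairs mixed <= 2 * num_pairs ahead_target)%nat.
  exact: num_pairs_cover_converse.
have : (num_pairs unit_rel <= num_pairs equal + num_pairs mixed)%nat.
  apply: num_pairs_cover => i j ij.
  rewrite /equal /mixed /ahead_both /ahead_neither /ahead_target -(unit_rel_sym i) ij.
  by case: (ahead i j); case: (ahead j i).
nia.
Qed.
End ConvexPolygon.

Lemma unit_edges_num_pairs (P : list point) :
  (2 * unit_edges P = num_pairs (unit_rel (@vertex P)))%nat.
Proof.
rewrite /num_pairs /unit_rel /vertex; elim: P => [|p P IH]; first by rewrite big_ord0.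
have edges_p : (length (filter (is_unit p) P) =
    \sum_(j < size P) is_unit p (nth (0, 0)%R P j))%nat.
  by elim: P {IH} => [|q P IH]; rewrite ?big_ord0 // big_ord_recl /= -IH; case: is_unit.
rewrite big_ord_recl big_ord_recl /= is_unit_irrefl add0n mulnDr IH mul2n -addnn edges_p.
rewrite -addnA; congr addn; under [RHS]eq_bigr do rewrite big_ord_recl.
rewrite big_split; congr addn; apply: eq_bigr => i _ /=.
by rewrite is_unit_sym.
Qed.

Lemma INR_trunc_log_le_log2 n : (0 < n)%nat -> INR (trunc_log 2 n) <= log2 (INR n).
Proof.
move=> n_gt0; have /andP[pow_le _] := trunc_log_bounds (isT : (1 < 2)%nat) n_gt0.
have ln2_gt0 : 0 < ln 2 by rewrite -ln_1; apply: ln_increasing; lra.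
have pow_gt0 : 0 < 2 ^ trunc_log 2 n by apply: pow_lt; lra.
have INR_expn k : INR (expn 2 k) = 2 ^ k.
  by elim: k => [|k IH]; rewrite ?expnS ?mult_INR ?IH //=; lra.
apply: (Rmult_le_reg_r (ln 2)) => //; rewrite -ln_pow; last by lra.
rewrite /log2 /Rdiv Rmult_assoc Rinv_l ?Rmult_1_r; last by lra.
have : 2 ^ trunc_log 2 n <= INR n by rewrite -INR_expn; apply/le_INR/leP.
by case=> [lt | ->]; [apply/Rlt_le/ln_increasing | apply: Rle_refl].
Qed.

Lemma unit_edges_le (P : list point) : convexly_independent P ->
  (unit_edges P <= size P * (2 * trunc_log 2 (size P) + 4))%nat.
Proof.
move=> /convexly_independent_convex_position P_convex.
have [s s_inj s_ccw] := counterclockwise_enumeration P_convex.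
have : (num_pairs (unit_rel (@vertex P)) <= size P * (4 * trunc_log 2 (size P) + 8))%nat.
  rewrite -(num_pairs_reindex _ s_inj).
  exact: num_pairs_unit_rel (inj_comp (convex_position_inj P_convex) s_inj) s_ccw.
by rewrite -unit_edges_num_pairs; nia.
Qed.

(* Restores [Peano.le] as the meaning of [<=] in [nat_scope]. *)
Import Peano.
Open Scope R_scope.

Theorem theorem4p3 :
  exists C : R,
    forall P : list point,
      NoDup P ->
      convexly_independent P ->
      (2 <= length P)%nat ->
      INR (unit_edges P) <=
        2 * INR (length P) * log2 (INR (length P)) + C * INR (length P).
Proof.
exists 4 => P _ P_indep n_ge2; rewrite -[length P]/(size P) in n_ge2 *.
have n_ge0 := pos_INR (size P).
have log_le : INR (trunc_log 2 (size P)) <= log2 (INR (size P)).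
  by apply: INR_trunc_log_le_log2; lia.
have /leP/le_INR := unit_edges_le P_indep.
by rewrite mult_INR plus_INR mult_INR /=; nra.
Qed.
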